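(* Let $W\in\mathcal{C}^1(\mathbb{R}^n,\mathbb{R})$ be a positive definite function ($W(0)=0$, $W(x)>0$ for $x\ne0$). 1. If $\nabla W(x)^\top J_nx-\left|\frac{\partial W}{\partial x_n}(x)\right|\le-F(x)$ for every $x\in\mathbb{R}^n$, then $V^{lim}_\infty(x)\le W(x)$ for every $x\in\mathbb{R}^n$. 2. If $V^{lim}_\infty\in\mathcal{C}^1(\mathbb{R}^n,\mathbb{R})$ and $\nabla W(x)^\top J_nx-\left|\frac{\partial W}{\partial x_n}(x)\right|\ge-F(x)$ for every $x\in\mathbb{R}^n$, then $V^{lim}_\infty(x)\ge W(x)$ for every $x\in\mathbb{R}^n$.
   Context: Let $n\ge1$ be an integer, $J_n$ the $n\times n$ Jordan block with eigenvalue $0$ (ones on the superdiagonal, zeros elsewhere) and $e_n$ the last canonical basis vector of $\mathbb{R}^n$. The control system is $\dot x=J_nx+e_nu$. The function $F:\mathbb{R}^n\to\mathbb{R}_{\ge0}$ is continuously differentiable, convex and positive definite ($F(0)=0$, $F(x)>0$ for $x\ne0$). $V^{lim}_\infty(x_0)=\inf_{u}\int_0^\infty F(x(t))\,dt$, where the infimum is over measurable controls $u\in L^\infty(\mathbb{R}_{\ge0},[-1,1])$ and $x(\cdot)$ is the trajectory of the control system with $x(0)=x_0$ and control $u$. *)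

(* Defs.v *)
(* The state space R^n with n >= 1 is 'cV[R]_n.+1, since
   matrices are normed modules only for nonzero dimensions. *)
From HB Require Import structures.
From mathcomp Require Import all_boot all_order all_algebra.
From mathcomp Require Import all_classical all_reals all_analysis.

Set Implicit Arguments.
Unset Strict Implicit.
Unset Printing Implicit Defensive.

Import Order.TTheory GRing.Theory Num.Theory.
Import numFieldNormedType.Exports.

Local Open Scope classical_set_scope.
Local Open Scope ring_scope.

Definition jordan0 (R : realType) (n : nat) : 'M[R]_n.+1 :=
  \matrix_(i, j) (i.+1 == j :> nat)%:R.

Definition last_vec (R : realType) (n : nat) : 'cV[R]_n.+1 :=
  delta_mx ord_max 0.

Definition partial_derive (R : realType) (n : nat) (f : 'cV[R]_n.+1 -> R)
    (i : 'I_n.+1) (x : 'cV[R]_n.+1) : R :=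
  'D_(delta_mx i 0) f x.

Definition grad (R : realType) (n : nat) (f : 'cV[R]_n.+1 -> R)
    (x : 'cV[R]_n.+1) : 'cV[R]_n.+1 :=
  \col_i partial_derive f i x.

Definition C1 (R : realType) (n : nat) (f : 'cV[R]_n.+1 -> R) : Prop :=
  (forall x, differentiable f x) /\ continuous (grad f).

(* A value function is a priori extended-real valued: being C^1 includes being
   finite everywhere. *)
Definition C1_ereal (R : realType) (n : nat) (V : 'cV[R]_n.+1 -> \bar R) : Prop :=
  exists2 v : 'cV[R]_n.+1 -> R, C1 v & forall x, V x = (v x)%:E.

Definition positive_definite (R : realType) (n : nat) (f : 'cV[R]_n.+1 -> R) : Prop :=
  f 0 = 0 /\ forall x, x != 0 -> 0 < f x.

(* Borel measurability: every Lebesgue measurable control is a.e. equal to a Borel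
   one, with the same trajectories. Only values on [0, +oo[ matter. *)
Definition admissible (R : realType) (u : R -> R) : Prop :=
  measurable_fun (`[0, +oo[ : set R) u /\ forall t, 0 <= t -> -1 <= u t <= 1.

(* Since u is merely measurable, x' = J_n x + u e_n is understood in the sense
   of Caratheodory, i.e. as an integral equation (which gives x 0 = x0). By
   continuity of x and boundedness of u, every integrand below is integrable. *)
Definition trajectory (R : realType) (n : nat) (x0 : 'cV[R]_n.+1) (u : R -> R)
    (x : R -> 'cV[R]_n.+1) : Prop :=
  {within `[0, +oo[, continuous x} /\
  forall t, 0 <= t -> forall i : 'I_n.+1,
    x t i 0 = x0 i 0 +
      \int[lebesgue_measure]_(s in `[0, t])
        (jordan0 R n *m x s + u s *: last_vec R n) i 0.

Definition Vlim (R : realType) (n : nat) (F : 'cV[R]_n.+1 -> R)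
    (x0 : 'cV[R]_n.+1) : \bar R :=
  ereal_inf [set c | exists u x, [/\ admissible u, trajectory x0 u x &
    c = (\int[lebesgue_measure]_(t in `[0%R, +oo[) (F (x t))%:E)%E]].

(* The Hamilton-Jacobi-Bellman expression grad W(x)^T J_n x - |dW/dx_n (x)|. *)
Definition hjb (R : realType) (n : nat) (W : 'cV[R]_n.+1 -> R)
    (x : 'cV[R]_n.+1) : R :=
  ((grad W x)^T *m jordan0 R n *m x) 0 0 - `|partial_derive W ord_max x|.

(* Main.v *)
(** Along any trajectory, the energy [W(x(t)) + int_0^t F(x)] has right
    increments [(t-s)(grad W(x(s)) . J x(s) + F(x(s))) + dW/dx_n(x(s)) int_s^t u]
    up to [o(t-s)].

    For 2, [|u| <= 1] and the inequality on [W] make the lower right Dini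
    derivative of the energy nonnegative, so [W(x0) <= W(x(T)) + int_0^T F(x)] for
    all [T]. If the total cost were smaller than [W(x0)], then [W(x(T))], hence
    [|x(T)|], hence (by convexity) [F(x(T))] would stay bounded away from zero and
    the cost would be infinite.

    For 1, the optimal feedback [u = - sg (dW/dx_n)] is discontinuous, so it is
    sampled and held: on [[m, m+1]] the reachable set is bounded uniformly in the
    control, and uniform continuity of [dW/dx_n] there gives a sampling period for
    which the energy grows by at most [e / 2^(m+1)]. The total cost of the
    resulting control is at most [W(x0) + e]. *)
Require Import Defs.
From HB Require Import structures.
From mathcomp Require Import all_boot all_order all_algebra.
From mathcomp Require Import all_classical all_reals all_analysis.
From mathcomp Require Import measurable_realfun.
From mathcomp Require Import ring lra.

Set Implicit Arguments.
Unset Strict Implicit.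
Unset Printing Implicit Defensive.

Import Order.TTheory GRing.Theory Num.Theory.
Import numFieldNormedType.Exports.

Local Open Scope classical_set_scope.
Local Open Scope ring_scope.

(** * Integrals and primitives of measurable, locally bounded functions of time *)

Definition locally_bounded (R : realType) (f : R -> R) : Prop :=
  forall T : R, exists M, forall t, `|t| <= T -> `|f t| <= M.

Section Integration.
Context {R : realType}.
Notation mu := (@lebesgue_measure R).
Implicit Types (f : R -> R) (a b c e t : R).

Lemma continuous_locally_bounded f : continuous f -> locally_bounded f.
Proof.
move=> cf T.
have /compact_bounded/ex_strict_bound_gt0[M M0 HM] : compact (f @` `[- T, T]).
  by apply: continuous_compact;
    [exact: continuous_subspaceT | exact: segment_compact].
exists M => t tT; apply/ltW/HM; exists t => //=.
by rewrite in_itv /= -ler_norml.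
Qed.

Lemma locally_bounded_integrable f a b :
  measurable_fun setT f -> locally_bounded f ->
  mu.-integrable `[a, b] (EFin \o f).
Proof.
move=> mf bf; apply: measurable_bounded_integrable => //.
- have [ab|ba] := leP a b; last by rewrite set_itv_ge ?measure0 ?ltry// -leNgt bnd_simp.
  by rewrite /= lebesgue_measure_itv /=; case: ifP => _; rewrite -?EFinB ltry.
- exact: measurable_funTS.
- have [M HM] := bf (Num.max `|a| `|b|).
  exists M; split; [exact: num_real|] => x Mx t /=; rewrite in_itv /= => /andP[at_ tb].
  apply: (le_trans (HM t _) (ltW Mx)).
  rewrite le_max; have [t0|t0] := leP 0 t; apply/orP; [right|left].
    by rewrite ger0_norm// (le_trans _ (ler_norm b)).
  by rewrite ltr0_norm// -(normrN a) (le_trans _ (ler_norm _))// lerN2.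
Qed.

Lemma Rintegral_itv_oc f a b :
  measurable_fun setT f -> locally_bounded f ->
  \int[mu]_(t in `]a, b]) f t = \int[mu]_(t in `[a, b]) f t.
Proof.
move=> mf bf; rewrite Rintegral_itv_obnd_cbnd//.
apply: integrableS (locally_bounded_integrable a b mf bf) => //.
exact: subset_itv_oc_cc.
Qed.

Lemma Rintegral_itv_split f a b c :
  measurable_fun setT f -> locally_bounded f -> a <= b -> b <= c ->
  \int[mu]_(t in `[a, c]) f t =
  \int[mu]_(t in `[a, b]) f t + \int[mu]_(t in `[b, c]) f t.
Proof.
move=> mf bf ab bc.
have /(@Rintegral_itvB _ _ _ _ b) := locally_bounded_integrable a c mf bf.
rewrite !bnd_simp => /(_ ab bc).
by rewrite Rintegral_itv_oc// => <-; rewrite addrC subrK.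
Qed.

Lemma Rintegral_itv_cst a b c : a <= b -> \int[mu]_(t in `[a, b]) c = c * (b - a).
Proof.
move=> ab; rewrite Rintegral_cst//= lebesgue_measure_itv /= lte_fin.
have [_|ba|->] := ltgtP a b; rewrite ?subrr ?EFinB ?mulr0//.
by rewrite leNgt ba in ab.
Qed.

Lemma Rintegral_itv_near f a b c e :
  measurable_fun setT f -> locally_bounded f -> a <= b ->
  (forall t, a <= t <= b -> `|f t - c| <= e) ->
  `|\int[mu]_(t in `[a, b]) f t - c * (b - a)| <= e * (b - a).
Proof.
move=> mf bf ab fce.
have If := locally_bounded_integrable a b mf bf.
have Ic d : mu.-integrable `[a, b] (EFin \o (fun=> d)).
  by apply: locally_bounded_integrable => // T; exists `|d|.
have IB : mu.-integrable `[a, b] (EFin \o (fun t => f t - c)).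
  by rewrite (_ : _ \o _ = (EFin \o f) \- (EFin \o (fun=> c)))%E//;
    exact: integrableB.
rewrite -(Rintegral_itv_cst c)// -RintegralB//.
apply: le_trans (le_normr_Rintegral _ _) _ => //.
rewrite -(Rintegral_itv_cst e)//; apply: le_Rintegral => //.
exact: (integrable_norm IB).
Qed.

Lemma Rintegral_itv_bound f a b e :
  measurable_fun setT f -> locally_bounded f -> a <= b ->
  (forall t, a <= t <= b -> `|f t| <= e) ->
  `|\int[mu]_(t in `[a, b]) f t| <= e * (b - a).
Proof.
move=> mf bf ab fe.
have := @Rintegral_itv_near f a b 0 e mf bf ab.
by rewrite mul0r subr0; apply => t /fe; rewrite subr0.
Qed.

(** The primitive is Lipschitz near [t0]; a bound of [f] on [|s| <= |t0| + 1] serves as the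
    constant. *)
Lemma Rintegral_itv_continuous f :
  measurable_fun setT f -> locally_bounded f ->
  continuous (fun t => \int[mu]_(s in `[0, t]) f s).
Proof.
move=> mf bf t0.
have [M HM] := bf (`|t0| + 1).
have M0 : 0 <= M by apply: le_trans (HM 0 _); rewrite ?normr0 // addr_ge0.
(* For [t <= 0] the interval [[0, t]] is empty or a single point, so the primitive vanishes there;
   this gives continuity on the whole line, not only on [[0, +oo[]. *)
have neg t : t <= 0 -> \int[mu]_(s in `[0, t]) f s = 0.
  rewrite le_eqVlt => /predU1P[->|t0']; first by rewrite set_itv1 Rintegral_set1.
  by rewrite set_itv_ge ?Rintegral_set0// -leNgt bnd_simp.
have lip a b : a <= b -> `|a| <= `|t0| + 1 -> `|b| <= `|t0| + 1 ->
    `|\int[mu]_(s in `[0, b]) f s - \int[mu]_(s in `[0, a]) f s| <= M * (b - a).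
  move=> ab aT bT.
  have [b0|b0] := leP b 0.
    by rewrite !neg ?subrr ?normr0 ?mulr_ge0 ?subr_ge0// (le_trans ab).
  have [a0|a0] := leP a 0.
    rewrite (neg a)// subr0; apply: (@le_trans _ _ (M * (b - 0))).
      apply: Rintegral_itv_bound => //; first exact: ltW.
      move=> t /andP[t0' tb]; apply: HM.
      by rewrite ger0_norm// (le_trans tb)// (le_trans (ler_norm _)).
    by apply: ler_wpM2l => //; lra.
  rewrite (Rintegral_itv_split mf bf (ltW a0) ab) addrC addKr.
  apply: Rintegral_itv_bound => // t /andP[at_ tb]; apply: HM.
  by rewrite ger0_norm ?(le_trans tb) ?(le_trans (ltW a0))// (le_trans (ler_norm _)).
have M1 : 0 < M + 1 by rewrite ltr_pwDr.
apply/cvgrPdist_le => e e0; near=> t.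
have tt : `|t0 - t| <= 1 by near: t; exact: cvgr_dist_le.
have te : M * `|t0 - t| <= e.
  apply: (@le_trans _ _ ((M + 1) * `|t0 - t|)).
    by rewrite ler_wpM2r// lerDl.
  rewrite -ler_pdivlMl//; near: t; apply: cvgr_dist_le => //.
  by rewrite mulr_gt0 ?invr_gt0.
have tT : `|t| <= `|t0| + 1.
  by rewrite -(subKr t0 t) (le_trans (ler_normB _ _))// lerD2l.
have t0T : `|t0| <= `|t0| + 1 by rewrite lerDl.
apply: le_trans te; have [h|/ltW h] := leP t t0.
- by rewrite (ger0_norm (x := t0 - t)) ?subr_ge0// lip.
- by rewrite distrC (distrC t0) (ger0_norm (x := t - t0)) ?subr_ge0// lip.
Unshelve. all: by end_near. Qed.

End Integration.

(** * A Dini-type monotonicity criterion, and compactness arguments in the sup norm *)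

Section Preliminaries.
Context {R : realType}.
Notation mu := (@lebesgue_measure R).

(** Tilt [G] to [H t = G t + e * t] and let [S] be the set of [t] in [[a, b]] with [H a <= H t]. Its
    supremum lies in [S] by continuity; were it below [b], the estimate to its right would produce a
    larger element. The slope [e] is then sent to 0. *)
Lemma dini_nondecreasing (G : R -> R) (a b : R) :
  a <= b -> continuous G ->
  (forall s, a <= s < b -> forall e, 0 < e ->
    exists2 d, 0 < d & forall t, s <= t < s + d -> G s - e * (t - s) <= G t) ->
  G a <= G b.
Proof.
move=> ab cG dG; apply/ler_addgt0Pr => e' e'0.
have [e [e0 ee']] : exists e, 0 < e /\ e * (b - a) <= e'.
  (* The [+ 1] keeps the denominator positive when [a = b]. *)
  exists (e' / (b - a + 1)); split; first by rewrite divr_gt0// ltr_wpDl ?subr_ge0.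
  rewrite -mulrA ler_piMr ?(ltW e'0)// mulrC ler_pdivrMr ?ltr_wpDl ?subr_ge0//.
  by rewrite mul1r lerDl.
suff : G a - e * (b - a) <= G b by lra.
pose H t := G t + e * t.
have cH : continuous H.
  by move=> t; apply: cvgD; [exact: cG|apply: cvgM; [exact: cvg_cst|exact: cvg_id]].
pose S := [set t | a <= t <= b /\ H a <= H t].
have Sa : S a by rewrite /S/= lexx ab.
have ubS : ubound S b by move=> t [/andP[]].
have supS : has_sup S by split; [exists a|exists b].
have ac : a <= sup S by apply: ub_le_sup => //; exists b.
have cb : sup S <= b by apply: sup_le_ub => //; exists a.
have HS : H a <= H (sup S).
  (* Otherwise [H < H a] on a whole neighbourhood of [sup S], which contains points of [S]. *)
  rewrite leNgt; apply/negP => Hlt.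
  have [r r0 Hr] : exists2 r, 0 < r & forall t, `|sup S - t| < r -> H t < H a.
    have /cvgr_lt/(_ _ Hlt) := cH (sup S).
    by move=> /nbhs_ballP[r r0 Hr]; exists r.
  have [t [/andP[at_ tb] Ht] tr] := sup_adherent r0 supS.
  have tc : t <= sup S by apply: ub_le_sup => //; [exists b|split => //; rewrite at_].
  suff : H t < H a by rewrite ltNge Ht.
  by apply: Hr; rewrite ger0_norm ?subr_ge0//; lra.
have [cltb|bc] := ltP (sup S) b; last first.
  have <- : sup S = b by apply/eqP; rewrite eq_le cb bc.
  by move: HS; rewrite /H; lra.
have [d d0 Hd] := dG (sup S) (introT andP (conj ac cltb)) _ e0.
pose t := Num.min (sup S + d / 2) b.
have tc : sup S < t by rewrite lt_min cltb ltrDl divr_gt0.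
have td : t < sup S + d by rewrite gt_min ltrD2l ltr_pdivrMr// ltr_pMr// ltrDl ltr01.
have tb : t <= b by rewrite ge_min lexx orbT.
suff /(ub_le_sup (ex_intro _ b ubS)) : S t by rewrite leNgt tc.
split; first by rewrite tb (le_trans ac (ltW tc)).
have := Hd t; rewrite td (ltW tc) => /(_ isT).
by move: HS; rewrite /H; lra.
Qed.

Lemma coord_le_norm m (v : 'cV[R]_m) i : `|v i 0| <= `|v|.
Proof.
rewrite [leRHS]/Num.norm/= mx_normrE.
by apply/bigmax_geP; right; exists (i, 0).
Qed.

Lemma norm_le_coord m (v : 'cV[R]_m) e : 0 <= e ->
  (forall i, `|v i 0| <= e) -> `|v| <= e.
Proof.
move=> e0 ve; rewrite [leLHS]/Num.norm/= mx_normrE.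
by apply/bigmax_leP; split => // -[i j] _ /=; rewrite (ord1 j).
Qed.

(** The norm is the sup norm, so the ball is a closed subset of a box, itself the transpose of a
    product of segments in the space of row vectors. *)
Lemma ball_compact m (r : R) : compact [set v : 'cV[R]_m | `|v| <= r].
Proof.
have tr_cont : continuous (@trmx R 1 m).
  move=> v /= A /nbhs_ballP[e e0 eA]; apply/nbhs_ballP; exists e => // w [_ vw].
  by apply: eA; split => // i j; rewrite !mxE; exact: vw.
have cK : compact [set v : 'rV[R]_m | forall i, `[- r, r]%classic (v ord0 i)].
  apply: (@rV_compact _ _ (fun=> `[- r, r]%classic)) => _; exact: segment_compact.
have cT := continuous_compact (continuous_subspaceT tr_cont) cK.
apply: subclosed_compact cT _; last first.
  move=> v /= vr; exists v^T; last by rewrite trmxK.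
  move=> i; rewrite in_itv/= mxE -ler_norml.
  exact: le_trans (coord_le_norm _ _) vr.
rewrite (_ : [set _ | _] = (fun v : 'cV[R]_m => `|v|) @^-1` [set x | x <= r])//.
by apply: closed_comp; [move=> *; exact: norm_continuous | exact: closed_le].
Qed.

Lemma uniformly_continuous_ball m (f : 'cV[R]_m -> R) (r e : R) :
  continuous f -> 0 < e ->
  exists2 d, 0 < d & forall y z, `|y| <= r -> `|z - y| < d -> `|f z - f y| <= e.
Proof.
move=> cf e0.
have /compact_near_coveringP := @ball_compact m r.
move=> /(_ R 0^'+ (fun d y => forall z, `|z - y| < d -> `|f z - f y| <= e) _).
move=> H; have {}H : \forall d \near 0^'+, forall y, `|y| <= r ->
    forall z, `|z - y| < d -> `|f z - f y| <= e.
  apply: H => y _.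
  have /cvgrPdist_le/(_ (e / 2)) := cf y.
  rewrite divr_gt0// => /(_ isT)/nbhs_ballP[d /= d0 Hd].
  (* Half of [d] is spent on moving the centre from [y] to [w], half on the increment from [w] to
     [z]; both points then lie within [d] of [y]. *)
  exists (ball y (d / 2), [set t | t < d / 2]) => /=.
    split; first by apply: nbhsx_ballx; rewrite divr_gt0.
    by apply: nbhs_right_lt; rewrite divr_gt0.
  move=> [w t] /= [yw td] z zw.
  rewrite mx_norm_ball /ball_/= in yw.
  have dd : d / 2 < d by lra.
  have Hw : `|f y - f w| <= e / 2.
    by apply: Hd; rewrite /= mx_norm_ball /ball_/=; exact: lt_trans yw dd.
  have Hz : `|f y - f z| <= e / 2.
    apply: Hd; rewrite /= mx_norm_ball /ball_/=.
    rewrite (le_lt_trans (ler_distD w _ _))// (distrC w z).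
    by lra.
  rewrite (le_trans (ler_distD (f y) _ _))// (distrC (f z)); lra.
have [d [d0 Hd]] : exists d : R, 0 < d /\ forall y, `|y| <= r ->
    forall z, `|z - y| < d -> `|f z - f y| <= e.
  near (0 : R)^'+ => d; exists d; split; last by near: d.
  by near: d; exact: nbhs_right_gt.
by exists d => // y z yr zd; exact: Hd.
Unshelve. all: by end_near. Qed.

(** [c] is the minimum of [F] on the sphere of radius [d]. Any [y] beyond it is pulled back to the
    sphere along the segment to 0, where convexity and [F 0 = 0] give [F ((d / |y|) *: y) <= (d /
    |y|) * F y <= F y]. *)
Lemma convex_posdef_lower_bound m (F : 'cV[R]_m.+1 -> R) (d : R) :
  continuous F -> convex_function [set: 'cV[R]_m.+1] F -> positive_definite F ->
  0 < d -> exists2 c, 0 < c & forall y, d <= `|y| -> c <= F y.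
Proof.
move=> cF xF [F0 Fpos] d0.
have F_ge0 y : 0 <= F y.
  by have [->|/Fpos/ltW//] := eqVneq y 0; rewrite F0.
pose S := [set v : 'cV[R]_m.+1 | `|v| = d].
have cS : compact S.
  apply: subclosed_compact (@ball_compact m.+1 d) _; last by move=> v /= ->.
  rewrite (_ : S = (fun v : 'cV[R]_m.+1 => `|v|) @^-1` [set d])//.
  by apply: closed_comp; [move=> *; exact: norm_continuous | exact: closed_eq].
have S0 : S !=set0.
  (* The all-ones column has sup norm 1, because there is at least one coordinate. *)
  exists (d *: (\col_i 1)); rewrite /S/= normrZ gtr0_norm//.
  suff -> : `|\col_(i < m.+1) (1 : R)| = 1 by rewrite mulr1.
  apply/eqP; rewrite eq_le; apply/andP; split.
    by apply: norm_le_coord => // i; rewrite mxE normr1.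
  by have := @coord_le_norm _ (\col_(i < m.+1) (1 : R)) 0; rewrite mxE normr1.
have [v vS vmin] := compact_EVT_min S0 cS (continuous_subspaceT cF).
exists (F v).
  apply: Fpos; apply/eqP => v0; move: vS; rewrite v0 => /set_mem.
  by rewrite /S/= normr0 => d00; rewrite -d00 ltxx in d0.
move=> y dy.
have y0 : 0 < `|y| := lt_le_trans d0 dy.
have l0 : 0 <= d / `|y| by rewrite divr_ge0// ltW.
have l1 : d / `|y| <= 1 by rewrite ler_pdivrMr// mul1r.
have le1 : F ((d / `|y|) *: y + (1 - d / `|y|) *: (0 : 'cV_m.+1)) <=
    d / `|y| * F y + (1 - d / `|y|) * F 0.
  exact: (xF (Itv01 l0 l1) y 0 (mem_set I) (mem_set I)).
rewrite scaler0 addr0 F0 mulr0 addr0 in le1.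
apply: le_trans (vmin ((d / `|y|) *: y) _) _.
  apply: mem_set; rewrite /S/= normrZ ger0_norm//.
  by rewrite divfK// gt_eqF.
by apply: (le_trans le1); rewrite ler_piMl.
Qed.

End Preliminaries.

(** * First-order expansion of the state and of [W] along a trajectory *)

Section Dynamics.
Context {R : realType} {n : nat}.
Notation mu := (@lebesgue_measure R).
Notation state := 'cV[R]_n.+1.
Implicit Types (u : R -> R) (x : R -> state) (p : state).

(** Counterpart of [admissible] on the whole line, so that integrands are measurable everywhere and
    no domain has to be tracked. *)
Definition control u := measurable_fun setT u /\ forall t, `|u t| <= 1.

Definition velocity u x (t : R) : state :=
  jordan0 R n *m x t + u t *: last_vec R n.

Definition solution p u x := [/\ control u, continuous x &
  forall t, 0 <= t -> forall i,
    x t i 0 = p i 0 + \int[mu]_(s in `[0, t]) velocity u x s i 0].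

Lemma control_locally_bounded u : control u -> locally_bounded u.
Proof. by move=> [_ u1] T; exists 1. Qed.

Lemma mulmx_coord_continuous m (A : 'M[R]_(m, n.+1)) x i : continuous x ->
  continuous (fun t => (A *m x t) i 0).
Proof.
move=> cx.
rewrite (_ : (fun t => _) = (fun t => \sum_j A i j * x t j 0)); last first.
  by apply/funext => t; rewrite mxE.
elim: index_enum => [|j r IHr].
  under eq_fun do rewrite big_nil; exact: cst_continuous.
under eq_fun do rewrite big_cons.
move=> t; apply: cvgD; last exact: IHr.
apply: cvgM; first exact: cvg_cst.
apply: (@continuous_comp _ _ _ x (fun M : state => M j 0)).
  exact: cx.
exact: (@coord_continuous R n.+1 1 j 0 (x t)).
Qed.

Arguments mulmx_coord_continuous {m} A {x} i.

Lemma velocity_coordE u x t i :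
  velocity u x t i 0 = (jordan0 R n *m x t) i 0 + u t * last_vec R n i 0.
Proof. by rewrite /velocity [LHS]mxE [X in _ + X]mxE. Qed.

Lemma velocity_measurable u x i : control u -> continuous x ->
  measurable_fun setT (fun t => velocity u x t i 0).
Proof.
move=> [mu1 _] cx; under eq_fun do rewrite velocity_coordE.
apply: measurable_funD.
  apply: continuous_measurable_fun; exact: mulmx_coord_continuous.
exact: measurable_funM.
Qed.

Lemma velocity_locally_bounded u x i : control u -> continuous x ->
  locally_bounded (fun t => velocity u x t i 0).
Proof.
move=> [_ u1] cx T.
have [M HM] := continuous_locally_bounded (mulmx_coord_continuous (jordan0 R n) i cx) T.
exists (M + `|last_vec R n i 0|) => t tT; rewrite velocity_coordE.
by rewrite (le_trans (ler_normD _ _))// lerD ?HM// normrM ler_piMl.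
Qed.

Lemma solution_increment p u x s t i : solution p u x -> 0 <= s -> s <= t ->
  x t i 0 - x s i 0 = \int[mu]_(r in `[s, t]) velocity u x r i 0.
Proof.
move=> [cu cx xE] s0 st.
rewrite !xE ?(le_trans s0)// (@Rintegral_itv_split _ _ 0 s t)//.
- by ring.
- exact: velocity_measurable.
- exact: velocity_locally_bounded.
Qed.

Lemma diff_grad (W : state -> R) y v : differentiable W y ->
  'd W y v = ((grad W y)^T *m v) 0 0.
Proof.
move=> dW; rewrite {1}(matrix_sum_delta v) linear_sum mxE; apply: eq_bigr => i _.
rewrite big_ord1 linearZ/= !mxE mulrC; congr (_ * _).
by rewrite /partial_derive deriveE.
Qed.

Lemma diff_last (W : state -> R) y : differentiable W y ->
  'd W y (last_vec R n) = partial_derive W ord_max y.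
Proof. by move=> dW; rewrite /partial_derive deriveE. Qed.

Lemma diff_bound (W : state -> R) y : differentiable W y ->
  exists2 K, 0 <= K & forall v, `|'d W y v| <= K * `|v|.
Proof.
move=> dW; exists (\sum_i `|grad W y i 0|); first by rewrite sumr_ge0.
move=> v; rewrite diff_grad// mxE (le_trans (ler_norm_sum _ _ _))// mulr_suml.
apply: ler_sum => i _; rewrite normrM mxE ler_wpM2l//; exact: coord_le_norm.
Qed.

(** The drift [J_n x] is continuous in time, hence nearly constant on a short interval. The control
    is only measurable, so its integral is kept exactly. *)
Lemma displacement_near p u x s e : solution p u x -> 0 <= s -> 0 < e ->
  exists2 d, 0 < d & forall t, s <= t < s + d ->
    `|x t - x s - ((t - s) *: (jordan0 R n *m x s) +
       (\int[mu]_(r in `[s, t]) u r) *: last_vec R n)| <= e * (t - s).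
Proof.
move=> sol s0 e0; have [cu cx xE] := sol.
have : \forall r \near s, forall i,
    `|(jordan0 R n *m x s) i 0 - (jordan0 R n *m x r) i 0| <= e.
  apply: (@filter_forall _ _ (fun (i : 'I_n.+1) r =>
    `|(jordan0 R n *m x s) i 0 - (jordan0 R n *m x r) i 0| <= e) (nbhs s)) => i.
  by have /cvgrPdist_le/(_ _ e0) := mulmx_coord_continuous (jordan0 R n) i cx s.
move=> /nbhs_ballP[d d0 Hd]; exists d => // t /andP[st tsd].
apply: norm_le_coord => [|i]; first by rewrite mulr_ge0 ?subr_ge0// ltW.
have mJ := continuous_measurable_fun (mulmx_coord_continuous (jordan0 R n) i cx).
have bJ := continuous_locally_bounded (mulmx_coord_continuous (jordan0 R n) i cx).
have bu := control_locally_bounded cu.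
have coordE (a b c : 'cV[R]_n.+1) (k l : R) :
    (a - b - (k *: c + l *: last_vec R n)) i 0 =
    a i 0 - b i 0 - l * last_vec R n i 0 - c i 0 * k.
  by rewrite !mxE; ring.
rewrite coordE (solution_increment i sol s0 st).
under eq_Rintegral do rewrite velocity_coordE.
rewrite RintegralD//; last 2 first.
- exact: locally_bounded_integrable.
- apply: locally_bounded_integrable; first by apply: measurable_funM => //; case: cu.
  move=> T; exists `|last_vec R n i 0| => r _.
  by rewrite normrM ler_piMl//; case: cu.
rewrite RintegralZr//; last by apply: locally_bounded_integrable => //; case: cu.
rewrite addrK; apply: Rintegral_itv_near => // r /andP[sr rt].
rewrite distrC; apply: Hd => /=.
by rewrite /ball/= ler0_norm; lra.
Qed.

(** As [x] need not be differentiable at [s], the chain rule is replaced by applying the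
    differential of [W] to the displacement expansion. Half of [e] pays for the displacement error,
    half for the remainder of the differential. *)
Lemma value_increment_near p u x (W : state -> R) s e :
  solution p u x -> differentiable W (x s) -> 0 <= s -> 0 < e ->
  exists2 d, 0 < d & forall t, s <= t < s + d ->
    `|W (x t) - W (x s) -
      ((t - s) * ((grad W (x s))^T *m jordan0 R n *m x s) 0 0 +
       partial_derive W ord_max (x s) * \int[mu]_(r in `[s, t]) u r)|
    <= e * (t - s).
Proof.
move=> sol dW s0 e0.
have [K K0 HK] := diff_bound dW.
pose J := jordan0 R n *m x s.
(* [C] is a Lipschitz constant of [x] at [s]: drift, control, and 1 for the displacement error. *)
pose C := `|J| + `|last_vec R n| + 1.
have C0 : 0 < C by rewrite ltr_wpDl// addr_ge0.
(* The displacement tolerance is at most 1 for the sake of [C], and small enough that the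
   differential, of norm at most [K], turns it into at most [e / 2]. *)
have e10 : 0 < Num.min 1 (e / 2 / (K + 1)).
  by rewrite lt_min ltr01 !divr_gt0// ltr_wpDl.
have e1K : Num.min 1 (e / 2 / (K + 1)) * K <= e / 2.
  apply: (@le_trans _ _ (e / 2 / (K + 1) * K)).
    by rewrite ler_wpM2r// ge_min lexx orbT.
  by rewrite -mulrA ler_piMr ?divr_ge0 ?(ltW e0)// mulrC ler_pdivrMr ?ltr_wpDl// mul1r lerDl.
have e11 : Num.min 1 (e / 2 / (K + 1)) <= 1 by rewrite ge_min lexx.
move: (Num.min _ _) e10 e1K e11 => e1 e10 e1K e11.
have [d1 d10 Hd1] := displacement_near sol s0 e10.
have /diff_locally/eqaddoP := dW.
have e20 : 0 < e / 2 / C by rewrite !divr_gt0.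
move=> /(_ _ e20)/nbhs_ballP[d2 /= d20 Hd2].
(* The bound [d2 / C] keeps the displacement, at most [C * (t - s)], within the radius [d2] where
   the remainder is small. *)
exists (Num.min d1 (Num.min 1 (d2 / C))).
  by rewrite !lt_min d10 ltr01 divr_gt0.
move=> t /andP[st].
rewrite -ltrBlDl !lt_min => /and3P[td1 t1 td2].
have ts0 : 0 <= t - s by rewrite subr_ge0.
set I := \int[mu]_(r in `[s, t]) u r.
have I1 : `|I| <= t - s.
  rewrite -[leRHS]mul1r; have [[mu1 u1] _ _] := sol.
  by apply: Rintegral_itv_bound => //; exact: control_locally_bounded.
have := Hd1 t; rewrite st -ltrBlDl td1 => /(_ isT); rewrite -/J -/I.
set v := x t - x s; set w := v - _ => wle.
have vE : v = (t - s) *: J + I *: last_vec R n + w by rewrite /w addrC subrK.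
have vC : `|v| <= C * (t - s).
  rewrite vE (le_trans (ler_normD _ _))// /C mulrDl mul1r lerD//; last first.
    by rewrite (le_trans wle)// ler_piMl.
  rewrite (le_trans (ler_normD _ _))// mulrDl lerD// normrZ.
    by rewrite ger0_norm// mulrC.
  by rewrite mulrC ler_wpM2l.
have dWv : 'd W (x s) v = (t - s) * ((grad W (x s))^T *m jordan0 R n *m x s) 0 0 +
    partial_derive W ord_max (x s) * I + 'd W (x s) w.
  rewrite vE 2!linearD !linearZ/= diff_grad// diff_last// mulmxA.
  by congr (_ + _ + _); rewrite mulrC.
have rem : `|W (x t) - W (x s) - 'd W (x s) v| <= e / 2 * (t - s).
  have := Hd2 v; rewrite mx_norm_ball /ball_/= sub0r normrN.
  have -> : `|v| < d2.
    by rewrite (le_lt_trans vC)// mulrC -ltr_pdivlMr.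
  move=> /(_ isT); rewrite !fctE /= {1}/v subrK opprD addrA => H.
  apply: le_trans H _; apply: (@le_trans _ _ (e / 2 / C * (C * (t - s)))).
    by rewrite ler_wpM2l// ltW.
  by rewrite mulrA divfK// gt_eqF.
have -> : W (x t) - W (x s) - ((t - s) * ((grad W (x s))^T *m jordan0 R n *m x s) 0 0 +
    partial_derive W ord_max (x s) * I) =
    (W (x t) - W (x s) - 'd W (x s) v) + 'd W (x s) w by rewrite dWv; ring.
rewrite (le_trans (ler_normD _ _))//.
have : `|'d W (x s) w| <= e / 2 * (t - s).
  rewrite (le_trans (HK _))// (le_trans (ler_wpM2l K0 wle))// mulrA.
  by rewrite ler_wpM2r// mulrC.
by lra.
Qed.

End Dynamics.

(** * Growth of the energy under the two Hamilton-Jacobi-Bellman inequalities *)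

Section Energy.
Context {R : realType} {n : nat}.
Notation mu := (@lebesgue_measure R).
Notation state := 'cV[R]_n.+1.
Implicit Types (u : R -> R) (x : R -> state) (p : state) (F W : state -> R).

Definition energy F W x (t : R) : R :=
  W (x t) + \int[mu]_(s in `[0, t]) F (x s).

Lemma running_cost_continuous F x : continuous F -> continuous x ->
  continuous (F \o x).
Proof. by move=> cF cx t; apply: continuous_comp; [exact: cx|exact: cF]. Qed.

Lemma running_cost_measurable F x : continuous F -> continuous x ->
  measurable_fun setT (F \o x).
Proof.
by move=> cF cx; apply: continuous_measurable_fun; exact: running_cost_continuous.
Qed.

Lemma running_cost_locally_bounded F x : continuous F -> continuous x ->
  locally_bounded (F \o x).
Proof.
by move=> cF cx; apply: continuous_locally_bounded; exact: running_cost_continuous.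
Qed.

Lemma energy_continuous F W x : continuous F -> continuous W -> continuous x ->
  continuous (energy F W x).
Proof.
move=> cF cW cx t; apply: cvgD.
  exact: running_cost_continuous.
apply: Rintegral_itv_continuous.
- exact: running_cost_measurable.
- exact: running_cost_locally_bounded.
Qed.

Lemma energy_increment_near F W p u x s e :
  solution p u x -> continuous F -> differentiable W (x s) -> 0 <= s -> 0 < e ->
  exists2 d, 0 < d & forall t, s <= t < s + d ->
    `|energy F W x t - energy F W x s -
      ((t - s) * (((grad W (x s))^T *m jordan0 R n *m x s) 0 0 + F (x s)) +
       partial_derive W ord_max (x s) * \int[mu]_(r in `[s, t]) u r)|
    <= e * (t - s).
Proof.
move=> sol cF dW s0 e0; have [cu cx xE] := sol.
have e20 : 0 < e / 2 by rewrite divr_gt0.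
have [d1 d10 Hd1] := value_increment_near sol dW s0 e20.
have cFx : continuous (F \o x) by exact: running_cost_continuous.
have /cvgrPdist_le/(_ _ e20)/nbhs_ballP[d2 /= d20 Hd2] := cFx s.
exists (Num.min d1 d2); first by rewrite lt_min d10.
move=> t /andP[st]; rewrite -ltrBlDl lt_min => /andP[td1 td2].
have := Hd1 t; rewrite st -ltrBlDl td1 => /(_ isT) H1.
have H2 : `|\int[mu]_(r in `[s, t]) (F \o x) r - F (x s) * (t - s)| <= e / 2 * (t - s).
  apply: (@Rintegral_itv_near _ (F \o x)) => //.
  - exact: running_cost_measurable.
  - exact: running_cost_locally_bounded.
  - move=> r /andP[sr rt]; rewrite distrC; apply: Hd2.
    by rewrite /ball/= ler0_norm; lra.
have EE r : energy F W x r = W (x r) + \int[mu]_(q in `[0, r]) (F \o x) q by [].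
rewrite !EE (@Rintegral_itv_split _ (F \o x) 0 s t)//; last 2 first.
- exact: running_cost_measurable.
- exact: running_cost_locally_bounded.
set I0 := \int[mu]_(q in `[0, s]) _.
move: H1 H2.
set I1 := \int[mu]_(r in `[s, t]) _; set I2 := \int[mu]_(r in `[s, t]) _.
rewrite !ler_norml => /andP[a1 a2] /andP[b1 b2].
by apply/andP; split; lra.
Qed.

(** Since [|int u| <= t - s], the control term is at least [- |dW/dx_n| * (t - s)]. What remains to
    first order is [(t - s) * (hjb W + F)], which is nonnegative. *)
Lemma energy_lower_bound F W p u x T :
  C1 F -> C1 W -> (forall y, hjb W y >= - F y) -> solution p u x -> 0 <= T ->
  W p <= energy F W x T.
Proof.
move=> [dF _] [dW _] HW sol T0; have [[mu1 u1] cx xE] := sol.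
have cF : continuous F by move=> y; exact: differentiable_continuous.
have cW : continuous W by move=> y; exact: differentiable_continuous.
have x0E : x 0 = p.
  apply/matrixP => i j; rewrite (ord1 j) xE// set_itv1 Rintegral_set1 addr0//.
have <- : energy F W x 0 = W p.
  by rewrite /energy set_itv1 Rintegral_set1 addr0 x0E.
apply: dini_nondecreasing => //; first exact: energy_continuous.
move=> s /andP[s0 sT] e e0.
have [d d0 Hd] := energy_increment_near sol cF (dW (x s)) s0 e0.
exists d => // t /andP[st td].
have := Hd t; rewrite st td => /(_ isT); rewrite ler_norml => /andP[+ _].
have := HW (x s); rewrite /hjb.
set D := (_ *m _) 0 0; set g := partial_derive _ _ _ => HD.
have I1 : `|\int[mu]_(r in `[s, t]) u r| <= t - s.
  by rewrite -[leRHS]mul1r Rintegral_itv_bound//; exact: control_locally_bounded.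
have gI : - (`|g| * (t - s)) <= g * \int[mu]_(r in `[s, t]) u r.
  rewrite lerNl (le_trans (ler_norm _))// normrN normrM ler_wpM2l//.
have : 0 <= (t - s) * (D + F (x s) - `|g|).
  by rewrite mulr_ge0 ?subr_ge0//; lra.
by lra.
Qed.

(** The Dini criterion is applied to [c * t - energy]. The slack [c] allows the constant value [v]
    to be only nearly optimal as the state moves during the hold. *)
Lemma energy_upper_bound F W p u x a b v c :
  C1 F -> C1 W -> (forall y, hjb W y <= - F y) -> solution p u x ->
  0 <= a -> a <= b -> (forall r, a < r <= b -> u r = v) ->
  (forall s, a <= s < b -> v * partial_derive W ord_max (x s) <=
     - `|partial_derive W ord_max (x s)| + c) ->
  energy F W x b <= energy F W x a + c * (b - a).
Proof.
move=> [dF _] [dW _] HW sol a0 ab uv Hv; have [[mu1 u1] cx xE] := sol.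
have cF : continuous F by move=> y; exact: differentiable_continuous.
have cW : continuous W by move=> y; exact: differentiable_continuous.
pose G t := c * t - energy F W x t.
suff : G a <= G b by rewrite /G; lra.
apply: dini_nondecreasing => //.
  move=> t; apply: cvgB; last exact: energy_continuous.
  by apply: cvgM; [exact: cvg_cst|exact: cvg_id].
move=> s /andP[as_ sb] e e0.
have s0 := le_trans a0 as_.
have [d d0 Hd] := energy_increment_near sol cF (dW (x s)) s0 e0.
exists (Num.min d (b - s)); first by rewrite lt_min d0 subr_gt0.
move=> t /andP[st]; rewrite -ltrBlDl lt_min => /andP[td tb].
have := Hd t; rewrite st -ltrBlDl td => /(_ isT); rewrite ler_norml => /andP[_].
have := HW (x s); rewrite /hjb.
have := Hv s; rewrite as_ sb => /(_ isT).
set D := (_ *m _) 0 0; set g := partial_derive _ _ _ => Hg HD.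
have -> : \int[mu]_(r in `[s, t]) u r = v * (t - s).
  rewrite -Rintegral_itv_cst//.
  have bu : locally_bounded u by exact: control_locally_bounded.
  (* The left endpoint is dropped because the value of [u] at [a] is not prescribed. *)
  rewrite -(@Rintegral_itv_oc _ u)// -(@Rintegral_itv_oc _ (fun=> v))//; last first.
    by move=> T; exists `|v|.
  apply: eq_Rintegral => r; rewrite inE/= in_itv/= => /andP[sr rt].
  by apply: uv; lra.
have : 0 <= (t - s) * (c - (D + F (x s) + v * g)).
  by rewrite mulr_ge0 ?subr_ge0//; lra.
by rewrite /G; lra.
Qed.

End Energy.

(** * Explicit trajectories by iterated primitives, with bounds uniform in the control *)

Section Existence.
Context {R : realType} {n : nat}.
Notation mu := (@lebesgue_measure R).
Notation state := 'cV[R]_n.+1.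
Implicit Types (u : R -> R) (p : state).

(* [J_n] shifts indices, so the coordinate of index [i] is the [(n - i).+1]-fold
   iterated primitive of the control; only values at [t >= 0] matter, and all
   primitives are constant for [t <= 0]. *)
Fixpoint integrator_chain p u (k : nat) : R -> R :=
  if k is k'.+1 then
    fun t => p (inord (n - k')) 0 + \int[mu]_(s in `[0, t]) integrator_chain p u k' s
  else u.

Definition response p u (t : R) : state :=
  \col_(i < n.+1) integrator_chain p u (n - i).+1 t.

Lemma integrator_chain_regular p u k : control u ->
  [/\ measurable_fun setT (integrator_chain p u k),
      locally_bounded (integrator_chain p u k) &
      (0 < k)%N -> continuous (integrator_chain p u k)].
Proof.
move=> cu; elim: k => [|k [mk bk _]].
  by split=> //; [case: cu|exact: control_locally_bounded].
have ck : continuous (integrator_chain p u k.+1).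
  move=> t; apply: cvgD; first exact: cvg_cst.
  exact: Rintegral_itv_continuous.
split=> //; first exact: continuous_measurable_fun.
exact: continuous_locally_bounded.
Qed.

(** Row [i] of [J_n] selects coordinate [i + 1], of chain index [n - i]. The last row vanishes and
    leaves [u] itself, of chain index 0. *)
Lemma velocity_response p u t i :
  velocity u (response p u) t i 0 = integrator_chain p u (n - i) t.
Proof.
rewrite velocity_coordE mxE.
have [->|ni] := eqVneq i ord_max.
  rewrite subnn big1 => [|j _]; last first.
    rewrite mxE /= (_ : (n.+1 == j) = false) ?mul0r//.
    by rewrite gtn_eqF.
  by rewrite add0r mxE !eqxx mulr1.
have iltn : (i < n)%N.
  rewrite ltn_neqAle -ltnS ltn_ord andbT; apply: contra ni => /eqP ni.
  exact/eqP/val_inj.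
rewrite [X in _ + _ * X]mxE (negbTE ni) mulr0 addr0.
have iS : (i.+1 < n.+1)%N by [].
rewrite (bigD1 (Ordinal iS))//= big1 ?addr0 => [|j jn].
  rewrite !mxE eqxx mul1r; congr (integrator_chain p u _ t).
  exact: subnSK.
rewrite mxE (_ : (i.+1 == j) = false) ?mul0r//.
by apply: contraNF jn => /eqP ij; apply/eqP/val_inj.
Qed.

Lemma response_solution p u : control u -> solution p u (response p u).
Proof.
move=> cu; split => //; last first.
  move=> t t0 i; rewrite mxE /= subKn ?inord_val; last by rewrite -ltnS.
  by congr (_ + _); apply: eq_Rintegral => s _; rewrite velocity_response.
move=> t; apply/cvgrPdist_le => e e0.
have : \forall s \near t, forall i,
    `|response p u t i 0 - response p u s i 0| <= e.
  apply: (@filter_forall _ _ (fun (i : 'I_n.+1) s =>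
    `|response p u t i 0 - response p u s i 0| <= e) (nbhs t)) => i.
  have [_ _ /(_ isT) ck] := integrator_chain_regular p (n - i).+1 cu.
  have /cvgrPdist_le/(_ _ e0) := ck t.
  by apply: filterS => s; rewrite !mxE.
apply: filterS => s Hs; apply: norm_le_coord => [|i]; first exact: ltW.
by have := Hs i; rewrite !mxE.
Qed.

(** Every primitive at [t] sees only earlier values. This lets a control be redefined after a
    sampling time without disturbing the past. *)
Lemma response_causal p u u' T t :
  (forall s, s <= T -> u s = u' s) -> t <= T -> response p u t = response p u' t.
Proof.
move=> uu' tT; suff H k s : s <= T -> integrator_chain p u k s = integrator_chain p u' k s.
  by apply/matrixP => i j; rewrite !mxE H.
elim: k s => [|k IHk] s sT /=; first exact: uu'.
congr (_ + _); apply: eq_Rintegral => r; rewrite inE/= in_itv/= => /andP[_ rs].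
by apply: IHk; exact: le_trans rs sT.
Qed.

(** One [B], chosen before the control, serves as bound and as Lipschitz constant, since the
    coordinates of the velocity are themselves members of the chain. *)
Lemma response_bounded p T : 0 <= T ->
  exists2 B, 0 < B & forall u, control u ->
    (forall t, 0 <= t <= T -> `|response p u t| <= B) /\
    (forall s t, 0 <= s -> s <= t -> t <= T ->
      `|response p u t - response p u s| <= B * (t - s)).
Proof.
(* [A] dominates both [|p|] and [|u|]. Integrating over [[0, T]] gives
   [|p| + T * b k <= A + T * b k], and [A <= b k] bounds this by [(1 + T) * b k = b k.+1]. *)
move=> T0; pose A := `|p| + 1; pose b k := A * (1 + T) ^+ k.
have A1 : 1 <= A by rewrite lerDr.
have T1 : 1 <= 1 + T by rewrite lerDl.
have b_ge0 k : 0 <= b k by rewrite mulr_ge0 ?exprn_ge0//; lra.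
have b_le k : (k <= n.+1)%N -> b k <= b n.+1.
  by move=> kn; rewrite ler_wpM2l ?ler_weXn2l//; lra.
have chain_bound u k : control u -> forall t, 0 <= t <= T ->
    `|integrator_chain p u k t| <= b k.
  move=> cu; elim: k => [|k IHk] t /andP[t0 tT] /=.
    by rewrite /b expr0 mulr1; case: cu => _ /(_ t) /le_trans; exact.
  have [mk bk _] := integrator_chain_regular p k cu.
  apply: (@le_trans _ _ (A + b k * T)).
    rewrite (le_trans (ler_normD _ _))// lerD//.
      by rewrite /A (le_trans (coord_le_norm _ _))// lerDl.
    apply: (@le_trans _ _ (b k * (t - 0))).
      apply: Rintegral_itv_bound => // s /andP[s0 st].
      by apply: IHk; rewrite s0 (le_trans st).
    by rewrite subr0 ler_wpM2l.
  rewrite {2}/b exprSr mulrA -/(b k) mulrDr mulr1 lerD2r.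
  by rewrite /b ler_peMr ?exprn_ege1//; lra.
exists (b n.+1).
  by rewrite mulr_gt0 ?exprn_gt0//; lra.
move=> u cu; split => [t tT|s t s0 st tT].
  apply: norm_le_coord => // i; rewrite mxE.
  by apply: (le_trans (chain_bound _ _ cu _ tT)); rewrite b_le// ltnS leq_subr.
have sol := response_solution p cu; have [_ cx _] := sol.
apply: norm_le_coord => [|i]; first by rewrite mulr_ge0// subr_ge0.
rewrite [X in `|X|](_ : _ = response p u t i 0 - response p u s i 0); last first.
  by rewrite !mxE.
rewrite (solution_increment i sol s0 st).
apply: Rintegral_itv_bound => //.
- exact: velocity_measurable.
- exact: velocity_locally_bounded.
- move=> r /andP[sr rt]; rewrite velocity_response.
  apply: (le_trans (chain_bound _ _ cu _ _)).
    by rewrite (le_trans s0 sr) (le_trans rt).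
  by rewrite b_le// (leq_trans (leq_subr _ _)).
Qed.

End Existence.

(** * Construction of a near-optimal control by sampling the feedback *)

Section SampleAndHold.
Context {R : realType} {n : nat}.
Notation mu := (@lebesgue_measure R).
Notation state := 'cV[R]_n.+1.
Variables (F W : state -> R).
Hypotheses (F_C1 : C1 F) (W_C1 : C1 W) (HW : forall y, hjb W y <= - F y).
Implicit Types (u : R -> R) (p : state).

Lemma eq_energy (x y : R -> state) T :
  (forall t, t <= T -> x t = y t) -> energy F W x T = energy F W y T.
Proof.
move=> xy; rewrite /energy xy//; congr (_ + _).
apply: eq_Rintegral => t; rewrite inE/= in_itv/= => /andP[_ tT].
by rewrite xy.
Qed.

Lemma energy_causal p u u' T : (forall s, s <= T -> u s = u' s) ->
  energy F W (response p u) T = energy F W (response p u') T.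
Proof.
by move=> uu'; apply: eq_energy => t; exact: response_causal.
Qed.

Lemma partial_derive_continuous i : continuous (partial_derive W i).
Proof.
move=> y; have [_ cg] := W_C1.
rewrite (_ : partial_derive W i = (fun M : state => M i 0) \o grad W); last first.
  by apply/funext => z; rewrite /= mxE.
by apply: continuous_comp; [exact: cg|exact: (@coord_continuous R n.+1 1 i 0)].
Qed.

Lemma control_hold u T v : control u -> `|v| <= 1 ->
  control (fun t => if t <= T then u t else v).
Proof.
move=> [mu1 u1] v1; split; last by move=> t; case: ifP.
apply: measurable_fun_ifT => //.
exact: measurable_fun_ler.
Qed.

(** One sampling step: after [a] the control is frozen at the feedback value computed at [a]. The
    state stays within [d] of its sampled position, so [dW/dx_n] varies by at most [c / 2]. *)
Lemma hold_extension p u a b (B d c : R) :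
  control u -> 0 <= a -> a <= b -> B * (b - a) < d ->
  (forall y z, `|y| <= B -> `|z - y| < d ->
    `|partial_derive W ord_max z - partial_derive W ord_max y| <= c / 2) ->
  (forall u', control u' ->
    (forall t, 0 <= t <= b -> `|response p u' t| <= B) /\
    (forall s t, 0 <= s -> s <= t -> t <= b ->
      `|response p u' t - response p u' s| <= B * (t - s))) ->
  exists u', [/\ control u', forall t, t <= a -> u' t = u t &
    energy F W (response p u') b <= energy F W (response p u) a + c * (b - a)].
Proof.
move=> cu a0 ab Bd HB Hu'.
pose g y := partial_derive W ord_max y.
pose v := - Num.sg (g (response p u a)).
have v1 : `|v| <= 1 by rewrite normrN normr_sg; case: (_ != 0).
pose u' t := if t <= a then u t else v.
have cu' : control u' by exact: control_hold.
have uu' t : t <= a -> u' t = u t by rewrite /u' => ->.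
exists u'; split => //.
rewrite -(energy_causal p uu').
apply: (energy_upper_bound (v := v) F_C1 W_C1 HW (response_solution p cu')) => //.
  by move=> r /andP[ar _]; rewrite /u' leNgt ar.
move=> s /andP[as_ sb]; rewrite -/(g _).
have [Hb Hl] := Hu' _ cu'.
have ya : response p u' a = response p u a by exact: response_causal uu' _.
have B0 : 0 <= B.
  by apply: le_trans (Hb a _) => //; rewrite a0.
have gs : `|g (response p u' s) - g (response p u' a)| <= c / 2.
  apply: HB; first by apply: Hb; rewrite a0.
  apply: le_lt_trans (Hl _ _ a0 as_ (ltW sb)) _.
  by apply: le_lt_trans Bd; rewrite ler_wpM2l// lerD2r ltW.
have vg : v * g (response p u' a) = - `|g (response p u' a)|.
  by rewrite /v ya mulNr -normrEsg.
move: (g (response p u' s)) (g (response p u' a)) gs vg => gS gA gs vg.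
move: v v1 vg {u' cu' uu' Hb Hl ya} => v v1 vg.
(* The variation is paid twice: once to replace [gS] by [gA] next to [v], once to return from
   [- |gA|] to [- |gS|]. *)
have : v * (gS - gA) <= c / 2.
  rewrite (le_trans (ler_norm _))// normrM (le_trans _ gs)//.
  by rewrite ler_piMl.
have : `|gS| - `|gA| <= c / 2 by exact: le_trans (lerB_dist _ _) gs.
rewrite mulrBr vg; lra.
Qed.

(** The unit interval is cut into [N] holds of length [1 / N] with [B / N < d]. As [B] and [d] do
    not depend on the control, [N] is fixed beforehand, and the errors [c / N] add up to [c]. *)
Lemma unit_extension p u m c : control u -> 0 < c ->
  exists u', [/\ control u', forall t, t <= m%:R -> u' t = u t &
    energy F W (response p u') m.+1%:R <= energy F W (response p u) m%:R + c].
Proof.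
move=> cu c0.
have m0 : (0 : R) <= m%:R by [].
have [B B0 HB] := @response_bounded _ _ p m.+1%:R (ler0n _ _).
have c20 : 0 < c / 2 by rewrite divr_gt0.
have [d d0 Hd] := uniformly_continuous_ball B (@partial_derive_continuous ord_max) c20.
have [N N0 HN] : exists2 N : nat, (0 < N)%N & B * N%:R^-1 < d.
  exists (Num.bound (B / d)).+1 => //.
  rewrite ltr_pdivrMr ?ltr0n// mulrC -ltr_pdivrMr//.
  rewrite (lt_le_trans (archi_boundP _)) ?ler_nat//.
  by rewrite divr_ge0// ltW.
have N0' : (0 : R) < N%:R by rewrite ltr0n.
suff H j : (j <= N)%N -> exists u', [/\ control u', forall t, t <= m%:R -> u' t = u t &
    energy F W (response p u') (m%:R + j%:R / N%:R) <=
    energy F W (response p u) m%:R + c * (j%:R / N%:R)].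
  by have := H N (leqnn N); rewrite divff ?gt_eqF// mulr1 -natr1.
elim: j => [_|j IHj jN].
  by exists u; split => //; rewrite mul0r mulr0 !addr0.
have [u1 [cu1 u1u E1]] := IHj (ltnW jN).
have jN0 : 0 <= j%:R / N%:R :> R by rewrite divr_ge0.
have stepE : m%:R + j.+1%:R / N%:R - (m%:R + j%:R / N%:R) = N%:R^-1 :> R.
  by rewrite -natr1 mulrDl mul1r; ring.
have am : (m%:R : R) <= m%:R + j%:R / N%:R by rewrite lerDl.
have a0 : 0 <= m%:R + j%:R / N%:R :> R by rewrite addr_ge0.
have ab : m%:R + j%:R / N%:R <= m%:R + j.+1%:R / N%:R :> R.
  by rewrite -subr_ge0 stepE invr_ge0.
have bm : m%:R + j.+1%:R / N%:R <= m.+1%:R :> R.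
  by rewrite -[leRHS]natr1 lerD2l ler_pdivrMr// mul1r ler_nat.
have BN : B * (m%:R + j.+1%:R / N%:R - (m%:R + j%:R / N%:R)) < d by rewrite stepE.
have [|u2 [cu2 u2u1 E2]] := hold_extension cu1 a0 ab BN Hd (p := p).
  move=> u' cu'; have [H1 H2] := HB _ cu'; split.
    by move=> t /andP[t0 tb]; apply: H1; rewrite t0 (le_trans tb).
  by move=> s t s0 st tb; apply: H2 => //; exact: le_trans tb bm.
exists u2; split => //.
  by move=> t tm; rewrite u2u1 ?u1u//; exact: le_trans tm am.
apply: (le_trans E2); rewrite stepE; apply: le_trans (lerD E1 (lexx _)) _.
by rewrite -[j.+1%:R]natr1 [in leRHS]mulrDl mul1r mulrDr addrA.
Qed.

Lemma near_optimal_control p e : 0 < e -> (forall y, 0 <= W y) ->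
  exists2 u, control u &
    forall m : nat, \int[mu]_(t in `[0, m%:R]) F (response p u t) <= W p + e.
Proof.
move=> e0 W0.
(* Bookkeeping of the error budget with [h = 2^-k]: after [k] unit intervals [e * (1 - h)] is spent,
   and the next one costs [e * h / 2]. *)
have halve w h : w + e * (1 - h) + e * (2^-1 * h) = w + e * (1 - 2^-1 * h) by field.
(* Being a control is a premise here, so that choice yields a total function [f] on all pairs, which
   can then be iterated. *)
pose extends (q : nat * (R -> R)) v := control q.2 -> [/\ control v,
  forall t, t <= q.1%:R -> v t = q.2 t &
  energy F W (response p v) q.1.+1%:R <=
  energy F W (response p q.2) q.1%:R + e / 2 ^+ q.1.+1].
have [f Hf] : {f & forall q, extends q (f q)}.
  apply: choice => -[m u].
  have [cu|ncu] := pselect (control u); last by exists u.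
  have em : 0 < e / 2 ^+ m.+1 by rewrite divr_gt0// exprn_gt0.
  by have [v Hv] := unit_extension p m cu em; exists v.
pose U := fix U m := if m is k.+1 then f (k, U k) else fun=> 0.
have cU m : control (U m).
  elim: m => [|m IHm]; last by have [] := Hf (m, U m) IHm.
  by split => [|t] /=; rewrite ?normr0.
have UU m k t : t <= m%:R -> U (m + k)%N t = U m t.
  move=> tm; elim: k => [|k IHk]; first by rewrite addn0.
  rewrite addnS -IHk; have [_ /= + _] := Hf ((m + k)%N, U (m + k)%N) (cU _).
  by apply; rewrite (le_trans tm)// ler_nat leq_addr.
(* Diagonal gluing: the [U m] extend one another, so [u] agrees with [U m] up to time [m]. *)
pose u t := U (Num.truncn t).+1 t.
have tS (t : R) : t <= (Num.truncn t).+1%:R by rewrite ltW// truncnS_gt.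
have uU m t : t <= m%:R -> u t = U m t.
  move=> tm; rewrite /u.
  have [le_m|lt_m] := leqP m (Num.truncn t).+1.
    by rewrite -(subnKC le_m) UU.
  by rewrite -(subnKC (ltnW lt_m)) UU.
have cu : control u.
  split; last by move=> t; have [_] := cU (Num.truncn t).+1; exact.
  (* [u] is the pointwise limit of the [U m], each value being eventually constant in [m]. *)
  apply: (measurable_fun_cvg (h := U)) => [m|t _]; first by case: (cU m).
  apply: cvg_near_cst.
  near=> m; apply/esym/uU.
  by near: m; exact: nbhs_infty_ger.
exists u => // m.
have EU k : energy F W (response p (U k)) k%:R <= W p + e * (1 - 2^-1 ^+ k).
  elim: k => [|k IHk].
    have sol := response_solution p (cU 0); have [_ _ xE] := sol.
    rewrite /energy set_itv1 Rintegral_set1 addr0 expr0 subrr mulr0 addr0.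
    suff -> : response p (U 0) 0 = p by [].
    by apply/matrixP => i j; rewrite (ord1 j) xE// set_itv1 Rintegral_set1 addr0.
  have [_ _ /= Ek] := Hf (k, U k) (cU k).
  apply: (le_trans Ek); apply: le_trans (lerD IHk (lexx _)) _.
  by rewrite -exprVn exprS halve.
have Em : energy F W (response p u) m%:R <= W p + e * (1 - 2^-1 ^+ m).
  by rewrite (energy_causal p (u' := U m)) => [|t]; [exact: EU|exact: uU].
apply: le_trans (le_trans Em _).
  (* The terminal value of [W] is nonnegative and is discarded. *)
  by rewrite /energy lerDr.
by rewrite lerD2l ler_piMr ?(ltW e0)// gerBl exprn_ge0.
Unshelve. all: by end_near. Qed.

End SampleAndHold.

(** * From the definitions of the statement to solutions on the line, and costs over an infinite
    horizon *)

Section ValueFunction.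
Context {R : realType} {n : nat}.
Notation mu := (@lebesgue_measure R).
Notation state := 'cV[R]_n.+1.
Implicit Types (u : R -> R) (x : R -> state) (p : state) (F W : state -> R).

(* The control is extended by [0] and the trajectory by its initial value. *)
Lemma trajectory_solution p u x : admissible u -> trajectory p u x ->
  exists u' x', solution p u' x' /\ forall t, 0 <= t -> x' t = x t.
Proof.
move=> [mu1 u1] [cx xE].
have mI : measurable (`[0, +oo[%classic : set R) by [].
exists (u \_ `[0, +oo[), (fun t => x (Num.max 0 t)).
have max_ge0 t : 0 <= Num.max 0 t :> R by rewrite le_max lexx.
have xmax t : 0 <= t -> x (Num.max 0 t) = x t by move=> /max_idPr ->.
split; last exact: xmax.
split.
- split; first exact/(measurable_restrictT _ mI).
  move=> t; rewrite patchE; case: ifPn => [/set_mem/=|_]; last by rewrite normr0.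
  by rewrite in_itv/= andbT ler_norml => /u1.
- move=> t.
  have /subspace_continuousP/(_ (Num.max 0 t)) := cx.
  rewrite /= in_itv/= andbT => /(_ (max_ge0 t)) H.
  apply: (@cvg_comp _ _ _ (Num.max 0) x _ _ _ _ H).
  move=> A; rewrite /within/= => HA.
  have cm : continuous (Num.max (0 : R)).
    by move=> s; apply: continuous_max; [exact: cst_continuous | exact: cvg_id].
  have near_t : \forall s \near t, Num.max 0 s \in `[0, +oo[ -> A (Num.max 0 s).
    exact: cm t _ HA.
  apply: filterS near_t => s; apply.
  by rewrite in_itv/= andbT; exact: max_ge0.
- move=> t t0 i; rewrite xmax// xE//; congr (_ + _).
  apply: eq_Rintegral => s /set_mem; rewrite /= in_itv/= => /andP[s0 st].
  rewrite /velocity xmax// patchE; case: ifPn => // /negP[].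
  by apply/mem_set; rewrite /= in_itv/= s0.
Qed.

Lemma solution_trajectory p u x : solution p u x -> admissible u /\ trajectory p u x.
Proof.
move=> [[mu1 u1] cx xE]; split; split.
- exact: measurable_funTS.
- by move=> t _; rewrite -ler_norml.
- exact: continuous_subspaceT.
- exact: xE.
Qed.

Lemma cost_le_infinite_cost F x T : continuous F -> continuous x ->
  (forall y, 0 <= F y) ->
  ((\int[mu]_(t in `[0%R, T]) F (x t))%:E <=
    \int[mu]_(t in `[0%R, +oo[) (F (x t))%:E)%E.
Proof.
move=> cF cx F0.
have mF : measurable_fun setT (F \o x) by exact: running_cost_measurable.
have iF : mu.-integrable `[0, T] (EFin \o (F \o x)).
  by apply: locally_bounded_integrable => //; exact: running_cost_locally_bounded.
rewrite fineK; last exact: (integrable_fin_num _ iF).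
apply: ge0_subset_integral => //.
- by apply/measurable_EFinP; exact: measurable_funTS.
- by move=> t _; rewrite lee_fin.
- by move=> t /=; rewrite !in_itv/= andbT => /andP[].
Qed.

(** Monotone convergence along the intervals [[0, m]], which exhaust the half-line. *)
Lemma infinite_cost_le F x (c : R) : continuous F -> continuous x ->
  (forall y, 0 <= F y) ->
  (forall m : nat, \int[mu]_(t in `[0, m%:R]) F (x t) <= c) ->
  (\int[mu]_(t in `[0%R, +oo[) (F (x t))%:E <= c%:E)%E.
Proof.
move=> cF cx F0 Fc.
have mF : measurable_fun setT (F \o x) by exact: running_cost_measurable.
have -> : `[0%R, +oo[%classic = \bigcup_(m : nat) `[0%R, (m%:R : R)]%classic.
  apply/seteqP; split => [t|t [m _]] /=; rewrite !in_itv/= andbT.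
    move=> t0; exists (Num.truncn t).+1 => //=.
    by rewrite in_itv/= t0 ltW// truncnS_gt.
  by case/andP.
have cvgF : (\int[mu]_(t in `[0%R, m%:R]) (F (x t))%:E @[m --> \oo] -->
   \int[mu]_(t in \bigcup_(m : nat) `[0%R, (m%:R : R)]%classic) (F (x t))%:E)%E.
  apply: (@ge0_nondecreasing_set_cvg_integral _ (measurableTypeR R) R
    (fun m : nat => `[0%R, (m%:R : R)]%classic) (fun t => (F (x t))%:E) mu).
  - apply/nondecreasing_seqP => m; rewrite subsetEset => t /=.
    rewrite !in_itv/= => /andP[-> /le_trans]; apply; by rewrite ler_nat.
  - by [].
  - by move=> m; apply/measurable_EFinP; exact: measurable_funTS.
  - by move=> m t _; rewrite lee_fin.
rewrite -(cvg_lim _ cvgF)//; apply: lime_le; first by apply/cvg_ex; eexists; exact: cvgF.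
apply: nearW => m.
have iF : mu.-integrable `[0, m%:R] (EFin \o (F \o x)).
  by apply: locally_bounded_integrable => //; exact: running_cost_locally_bounded.
by have := Fc m; rewrite -lee_fin fineK//; exact: (integrable_fin_num _ iF).
Qed.

Lemma infinite_cost_ge F W p u x : C1 F ->
  convex_function [set: state] F -> positive_definite F ->
  C1 W -> positive_definite W -> (forall y, hjb W y >= - F y) ->
  solution p u x ->
  ((W p)%:E <= \int[mu]_(t in `[0%R, +oo[) (F (x t))%:E)%E.
Proof.
move=> F_C1 F_convex F_posdef W_C1 W_posdef HW sol; have [_ cx _] := sol.
have [F0 Fpos] := F_posdef.
have cF : continuous F by move=> y; have [dF _] := F_C1; exact: differentiable_continuous.
have cW : continuous W by move=> y; have [dW _] := W_C1; exact: differentiable_continuous.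
have F_ge0 y : 0 <= F y.
  by have [->|/Fpos/ltW//] := eqVneq y 0; rewrite F0.
have leC T := cost_le_infinite_cost T cF cx F_ge0.
set C := (\int[mu]_(t in _) _)%E in leC *.
rewrite leNgt; apply/negP => CW.
have C0 : (0 <= C)%E by apply: integral_ge0 => t _; rewrite lee_fin.
have Cfin : C \is a fin_num by rewrite ge0_fin_numE// (lt_trans CW)// ltry.
move: leC CW; rewrite -(fineK Cfin) => leC; rewrite lte_fin => CW.
move: (fine C) leC CW => {C C0 Cfin} C leC CW.
have {}leC T : \int[mu]_(t in `[0, T]) F (x t) <= C by have := leC T; rewrite lee_fin.
pose e := W p - C.
have e0 : 0 < e by rewrite subr_gt0.
have We T : 0 <= T -> e <= W (x T).
  move=> T0; have := energy_lower_bound F_C1 W_C1 HW sol T0.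
  by rewrite /energy /e; have := leC T; lra.
(* By continuity of [W] at 0, where it vanishes, [W (x T) >= e] keeps the state at distance at least
   [d] from 0. *)
have [d d0 Hd] : exists2 d, 0 < d & forall y, `|y| < d -> W y < e.
  have [W0 _] := W_posdef; rewrite -W0 in e0.
  have /cvgr_lt/(_ _ e0)/nbhs_ballP[d /= d0 Hd] := cW 0.
  by exists d => // y yd; apply: Hd; rewrite mx_norm_ball /ball_/= sub0r normrN.
have [c c0 Hc] := convex_posdef_lower_bound cF F_convex F_posdef d0.
have Fx t : 0 <= t -> c <= F (x t).
  move=> t0; apply: Hc; rewrite leNgt; apply/negP => /Hd.
  by rewrite ltNge We.
have cT T : 0 <= T -> c * T <= C.
  move=> T0; rewrite -{1}[T]subr0 -Rintegral_itv_cst//.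
  apply: le_trans (leC T); apply: le_Rintegral => //.
  - by apply: locally_bounded_integrable => // S; exists `|c|.
  - apply: (@locally_bounded_integrable _ (F \o x)).
      exact: running_cost_measurable.
    exact: running_cost_locally_bounded.
  - by move=> t /=; rewrite in_itv/= => /andP[t0 _]; exact: Fx.
have C0 : 0 <= C by have := cT 0 (lexx _); rewrite mulr0.
(* At this time the bound [c * T <= C] reads [C + c <= C]. *)
have := cT (C / c + 1); rewrite mulrDr mulrCA divff ?gt_eqF//.
have CC : 0 <= C / c + 1 by rewrite addr_ge0// divr_ge0// ltW.
by move=> /(_ CC); lra.
Qed.

End ValueFunction.

Theorem proposition7p7 (R : realType) (n : nat)
    (F : 'cV[R]_n.+1 -> R)
    (F_C1 : C1 F)
    (F_convex : convex_function [set: 'cV[R]_n.+1] F)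
    (F_posdef : positive_definite F)
    (W : 'cV[R]_n.+1 -> R)
    (W_C1 : C1 W)
    (W_posdef : positive_definite W) :
  ((forall x, hjb W x <= - F x) ->
     forall x, (Vlim F x <= (W x)%:E)%E) /\
  (C1_ereal (Vlim F) -> (forall x, hjb W x >= - F x) ->
     forall x, (Vlim F x >= (W x)%:E)%E).
Proof.
have F_ge0 y : 0 <= F y.
  by case: F_posdef => F0 Fpos; have [->|/Fpos/ltW//] := eqVneq y 0; rewrite F0.
have W_ge0 y : 0 <= W y.
  by case: W_posdef => W0 Wpos; have [->|/Wpos/ltW//] := eqVneq y 0; rewrite W0.
have cF : continuous F by move=> y; have [dF _] := F_C1; exact: differentiable_continuous.
split => [HW p|_ HW p].
  apply/lee_addgt0Pr => e e0.
  have [u cu Hu] := near_optimal_control F_C1 W_C1 HW p e0 W_ge0.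
  have sol := response_solution p cu; have [_ cx _] := sol.
  have [adm traj] := solution_trajectory sol.
  apply: le_trans (infinite_cost_le cF cx F_ge0 Hu).
  by apply: ereal_inf_lbound; exists u, (response p u).
apply: le_ereal_inf_tmp => _ [u [x [adm traj ->]]].
(* The competitor is replaced by a solution on the whole line that agrees with it for [t >= 0] and
   so has the same cost. *)
have [u' [x' [sol xx']]] := trajectory_solution adm traj.
apply: le_trans (infinite_cost_ge F_C1 F_convex F_posdef W_C1 W_posdef HW sol) _.
rewrite le_eqVlt; apply/orP; left; apply/eqP; apply: eq_integral => t /set_mem.
by rewrite /= in_itv/= andbT => t0; rewrite xx'.
Qed.
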